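(* Let $m\ge1$, $n\ge2$ be integers with $\gcd(m,n)=1$ and $|n-m|\ge2$. Let $\beta$ be the $\mathbb{Z}_{|n-m|}$-action on $\mathcal{O}_{(m,n)}(\mathbb{T})$ given by $\beta_t(z)=tz$, $\beta_t(S_1)=S_1$. Then the fixed point algebra of $\beta$ is the $C^*$-subalgebra $C^*(z^{|n-m|},S_1)$ of $\mathcal{O}_{(m,n)}(\mathbb{T})$ generated by $z^{|n-m|}$ and $S_1$, which is isomorphic to $\mathcal{O}_{(m,n)}(\mathbb{T})$.
   Context: For positive integers $m,n$ with $\gcd(m,n)=1$, $\mathcal{O}_{(m,n)}(\mathbb{T})$ is the universal $C^*$-algebra generated by a unitary $z$ and isometries $S_1,\dots,S_n$ satisfying $zS_i=S_{i+1}$ ($1\le i\le n-1$), $zS_n=S_1z^m$, $\sum_{i=1}^nS_iS_i^*=1$. (Thus $S_i=z^{i-1}S_1$, and the algebra is generated by $z$ and $S_1$.) The cyclic group $\mathbb{Z}_{|n-m|}$ is identified with the group of $|n-m|$-th roots of unity $t\in\mathbb{T}$; the action $\beta:\mathbb{Z}_{|n-m|}\to\mathrm{Aut}(\mathcal{O}_{(m,n)}(\mathbb{T}))$ is well defined. *)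

(* Defs.v *)
From HB Require Import structures.
From mathcomp Require Import all_boot all_order all_algebra.
From mathcomp Require Import complex.
From mathcomp Require Import all_classical all_reals all_analysis.

Set Implicit Arguments.
Unset Strict Implicit.
Unset Printing Implicit Defensive.

Import Order.TTheory GRing.Theory Num.Theory.
Import numFieldNormedType.Exports.

Local Open Scope classical_set_scope.
Local Open Scope ring_scope.
Local Open Scope complex_scope.

(* Unital C*-algebras over the complex numbers R[i].  MathComp algebras satisfy
   1 != 0, so the zero algebra is excluded.  There is no join of the algebra
   and norm hierarchies of the library: the norm is first given as a function
   cnorm, and the library's normed module structure is put on the alias
   normed_of A of A. *)
HB.mixin Record isPreCStarAlgebra (R : realType) A & GRing.Algebra R[i] A := {
  star : A -> A ;
  starK : involutive star ;
  starD : {morph star : x y / x + y} ;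
  starZ : forall (a : R[i]) (x : A), star (a *: x) = Num.conj a *: star x ;
  starM : forall x y : A, star (x * y) = star y * star x ;
  cnorm : A -> R ;
  cnormD : forall x y : A, cnorm (x + y) <= cnorm x + cnorm y ;
  cnormZ : forall (a : R[i]) (x : A),
    (cnorm (a *: x))%:C = `|a| * (cnorm x)%:C ;
  cnorm0_eq0 : forall x : A, cnorm x = 0 -> x = 0 ;
  cnormM : forall x y : A, cnorm (x * y) <= cnorm x * cnorm y ;
  cnorm_starM : forall x : A, cnorm (star x * x) = cnorm x ^+ 2
}.

#[short(type="preCStarAlgType")]
HB.structure Definition PreCStarAlgebra (R : realType) :=
  {A of isPreCStarAlgebra R A & GRing.Algebra R[i] A}.

Definition normed_of (R : realType) (A : preCStarAlgType R) : Type := A.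

Section NormedOf.
Context {R : realType} (A : preCStarAlgType R).

HB.instance Definition _ := GRing.Lmodule.on (normed_of A).

Let norm (x : normed_of A) : R[i] := (cnorm (x : A))%:C.

Let normD (x y : normed_of A) : norm (x + y) <= norm x + norm y.
Proof. by rewrite /norm -rmorphD /= lecR cnormD. Qed.

Let normZ (a : R[i]) (x : normed_of A) : norm (a *: x) = `|a| * norm x.
Proof. exact: cnormZ. Qed.

Let norm0_eq0 (x : normed_of A) : norm x = 0 -> x = 0.
Proof. by move=> [] /cnorm0_eq0. Qed.

HB.instance Definition _ :=
  Lmodule_isNormed.Build R[i] (normed_of A) normD normZ norm0_eq0.

End NormedOf.

HB.mixin Record isCStarComplete (R : realType) A & PreCStarAlgebra R A := {
  cstar_complete : forall F : set_system (normed_of A),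
    ProperFilter F -> cauchy F -> cvg F
}.

#[short(type="cstarAlgType")]
HB.structure Definition CStarAlgebra (R : realType) :=
  {A of isCStarComplete R A & PreCStarAlgebra R A}.

HB.instance Definition _ (R : realType) (A : cstarAlgType R) :=
  Uniform_isComplete.Build (normed_of A) cstar_complete.

Section CStarNotions.
Context {R : realType}.
Implicit Types A B : cstarAlgType R.

Definition unitary A (u : A) : Prop := star u * u = 1 /\ u * star u = 1.

Definition isometry A (s : A) : Prop := star s * s = 1.

(* Not required to contain 1. *)
Definition cstar_subalgebra A (D : set A) : Prop :=
  [/\ closed (D : set (normed_of A)),
      D 0,
      (forall (a : R[i]) x y, D x -> D y -> D (a *: x + y)),
      (forall x y, D x -> D y -> D (x * y)) &
      (forall x, D x -> D (star x))].

Definition cstar_gen A (X : set A) : set A := smallest (@cstar_subalgebra A) X.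

(* Not required to map 1 to 1. *)
Definition star_morphism A B (f : A -> B) : Prop :=
  [/\ (forall (a : R[i]) x y, f (a *: x + y) = a *: f x + f y),
      {morph f : x y / x * y} &
      {morph f : x / star x}].

Definition star_automorphism A (f : A -> A) : Prop :=
  star_morphism f /\ bijective f.

Definition star_isomorphic_to_subalgebra A B (D : set B) : Prop :=
  exists f : A -> B, star_morphism f /\ set_bij [set: A] D f.

(* An action by *-automorphisms of the cyclic group of order d, realised as
   the group of d-th roots of unity in R[i]; the values of beta at other
   scalars are irrelevant. *)
Definition unity_root_action (d : nat) A (beta : R[i] -> A -> A) : Prop :=
  [/\ (forall t, d.-unity_root t -> star_automorphism (beta t)),
      beta 1 =1 id &
      (forall s t, d.-unity_root s -> d.-unity_root t ->
         beta (s * t) =1 beta s \o beta t)].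

Definition fixed_points (d : nat) A (beta : R[i] -> A -> A) : set A :=
  [set x | forall t, d.-unity_root t -> beta t x = x].

(* In the next two definitions the isometries are S 1, ..., S n; the values of
   S at other indices are irrelevant. *)
Definition O_relations (m n : nat) A (z : A) (S : nat -> A) : Prop :=
  [/\ unitary z,
      (forall i, (1 <= i <= n)%N -> isometry (S i)),
      (forall i, (1 <= i < n)%N -> z * S i = S i.+1),
      z * S n = S 1 * z ^+ m &
      \sum_(1 <= i < n.+1) S i * star (S i) = 1].

(* (A, z, S) is the universal C*-algebra O_(m,n)(T), determined up to a unique
   isomorphism by its universal property. *)
Definition is_O (m n : nat) A (z : A) (S : nat -> A) : Prop :=
  [/\ O_relations m n z S,
      cstar_gen ([set z] `|` [set S i | i in [set i | (1 <= i <= n)%N]])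
        = [set: A] &
      forall (B : cstarAlgType R) (w : B) (T : nat -> B),
        O_relations m n w T ->
        let extends (f : A -> B) :=
          [/\ star_morphism f, f z = w &
              forall i, (1 <= i <= n)%N -> f (S i) = T i] in
        exists! f : A -> B, extends f].

End CStarNotions.

(* Main.v *)
Require Import Defs.
From HB Require Import structures.
From mathcomp Require Import all_boot all_order all_algebra.
From mathcomp Require Import complex.
From mathcomp Require Import all_classical all_reals all_analysis.
From mathcomp Require Import lra zify.
From mathcomp Require cyclic separable cyclotomic.

Set Implicit Arguments.
Unset Strict Implicit.
Unset Printing Implicit Defensive.

Import Order.TTheory GRing.Theory Num.Theory.
Import numFieldNormedType.Exports.

Local Open Scope classical_set_scope.
Local Open Scope ring_scope.
Local Open Scope complex_scope.

(** Write s for the isometry S 1 and d for the distance from n to m.  The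
relations say that z is unitary, that s is an isometry, that z^n s = s z^m, and
that the n projections z^i s (star s) (star z)^i with i < n sum to 1
([corner_rep] with P = 1).  As m and n are coprime and differ by d, both are
coprime to d.

Fixed points.  The average E of beta over the d-th roots of unity is a
contraction that fixes the fixed points and is linear over any algebra of fixed
points, in particular over D = C*(z^d, s).  Conjugation by z^n sends s to
s z^(m - n), which lies in D; as n is invertible modulo d, every z^j is a power
of z^n up to a power of z^d, so every z^j conjugates s into D.  Hence the closed
subspace M of all a such that E (z^j a) lies in D for every j is stable under
left multiplication by z, by s and by their adjoints, and therefore by the whole
algebra.  It contains 1, so it is everything, and j = 0 shows that each fixed
point x = E x lies in D.

Isomorphism.  The projection z^k s (star s) (star z)^k depends only on k modulo
n, and d is invertible modulo n, so the pair (z^d, s) satisfies the relations as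
well.  The universal property gives an endomorphism f with f z = z^d and
f s = s.  It is undone by adjoining a d-th root of z.  Iterating the isometries
S i yields Cuntz families V of any large size inside A, and so matrices over A
inside A itself.  With v_k = V_(k mod d) z^(k div d), the equations
w v_k = v_(k + 1) and t v_(m q) = v_(n q) s define operators w and t on the span
of V_0, ..., V_(d - 1); on the other V_i they are copies of z and s.  The pair
(w, t) satisfies the relations, hence gives an endomorphism g.  The identities
w^d v_0 = v_0 z and t v_0 = v_0 s, together with those for the adjoints, imply
g (f a) v_0 = v_0 a for every a.  As
*-morphisms are contractive, f is isometric; so it is injective with closed
range, and that range is C*(z^d, s).

Two facts about C*-algebras carry the argument: *-morphisms are contractive
([star_morphism_contractive]), and isometries whose range projections sum to 1
have orthogonal ranges ([isometries_orthogonal]).  Both follow from the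
existence of a square root of 1 - a for self-adjoint a of norm less than 1
([sqrt_one_sub]), without any spectral theory. *)

(** * Norm and adjoint *)

Section Norm.
Context {R : realType} {A : cstarAlgType R}.
Implicit Types x y : A.

Lemma cnormZr (r : R) x : cnorm (r%:C *: x) = `|r| * cnorm x.
Proof.
have := cnormZ (r%:C) x.
by rewrite normc_def /= expr0n addr0 sqrtr_sqr -rmorphM => /complexI.
Qed.

Lemma cnorm0 : cnorm (0 : A) = 0.
Proof. by rewrite -(scale0r (0 : A)) (cnormZr 0) normr0 mul0r. Qed.

Lemma cnormN x : cnorm (- x) = cnorm x.
Proof.
have -> : - x = (-1)%:C *: x by rewrite rmorphN1 scaleN1r.
by rewrite cnormZr normrN1 mul1r.
Qed.

Lemma cnormB x y : cnorm (x - y) <= cnorm x + cnorm y.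
Proof. by rewrite (le_trans (cnormD _ _)) // cnormN. Qed.

Lemma cnorm_distC x y : cnorm (x - y) = cnorm (y - x).
Proof. by rewrite -cnormN opprB. Qed.

Lemma cnorm_ge0 x : 0 <= cnorm x.
Proof. by have := cnormB x x; rewrite subrr cnorm0; lra. Qed.

Lemma cnorm_star x : cnorm (star x) = cnorm x.
Proof.
suff le_star y : cnorm y <= cnorm (star y).
  by apply/eqP; rewrite eq_le le_star andbT -{2}[x]starK le_star.
have := cnorm_starM y; have := cnormM (star y) y.
have := cnorm_ge0 y; have := cnorm_ge0 (star y).
rewrite le_eqVlt => /orP[/eqP <-|s0]; rewrite le_eqVlt => /orP[/eqP <-|y0] //.
- by nra.
- by nra.
by move=> + E; rewrite E expr2 ler_pM2r.
Qed.

Lemma star0 : star (0 : A) = 0.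
Proof. by apply: (addrI (star 0)); rewrite -starD !addr0. Qed.

Lemma starN x : star (- x) = - star x.
Proof. by apply: (addrI (star x)); rewrite -starD !subrr star0. Qed.

Lemma starB x y : star (x - y) = star x - star y.
Proof. by rewrite starD starN. Qed.

Lemma star1 : star (1 : A) = 1.
Proof. by rewrite -[LHS]mul1r -{1}(starK 1) -starM mul1r starK. Qed.

Lemma star_sum (I : Type) (s : seq I) (P : pred I) (F : I -> A) :
  star (\sum_(i <- s | P i) F i) = \sum_(i <- s | P i) star (F i).
Proof. exact: (big_morph star (@starD _ _) star0). Qed.

Lemma starZr (r : R) x : star (r%:C *: x) = r%:C *: star x.
Proof.
rewrite starZ; congr (_ *: _); apply: CrealP.
by rewrite complex_real.
Qed.

Lemma star_mul_eq0 x : star x * x = 0 -> x = 0.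
Proof.
move=> E; apply: cnorm0_eq0; have := cnorm_starM x.
by rewrite E cnorm0 => /esym/eqP; rewrite sqrf_eq0 => /eqP.
Qed.

Lemma cnorm_proj x : star x * x = x -> cnorm x <= 1.
Proof.
move=> E; have := cnorm_starM x; rewrite E; have := cnorm_ge0 x.
by rewrite le_eqVlt => /orP[/eqP <-|x0] //; nra.
Qed.

Lemma cnorm_le1_star x : cnorm (star x * x) <= 1 -> cnorm x <= 1.
Proof. by rewrite cnorm_starM; have := cnorm_ge0 x; nra. Qed.

Lemma cnorm_eq0_lim x (C : R) :
  (forall e, 0 < e -> cnorm x <= C * e) -> x = 0.
Proof.
move=> H; apply: cnorm0_eq0; apply/eqP; rewrite eq_le cnorm_ge0 andbT.
have [C0|C0] := leP C 0; first by have := H 1 ltr01; lra.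
apply/ler_addgt0Pr => e e0; rewrite add0r.
by have := H (e / C); rewrite mulrCA divff ?gt_eqF // mulr1; apply; apply: divr_gt0.
Qed.

End Norm.

(** * Closed sets and limits in terms of the real norm *)

Section Topology.
Context {R : realType} {A : cstarAlgType R}.
Implicit Types (x y : A) (D : set A).

(** The norm of [normed_of A] takes values in R[i]; its positive radii are the
positive reals, so closedness can be tested with the real-valued norm. *)
Lemma closedP_cnorm D :
  closed (D : set (normed_of A)) <->
  (forall x, (forall e : R, 0 < e -> exists2 y, D y & cnorm (x - y) < e) -> D x).
Proof.
split=> [cD x H|H x cx].
  apply: cD => B /= /nbhs_normP [e /= e0 eB].
  have eR : e = (complex.Re e)%:C.
    by case: e e0 {eB} => a b; rewrite ltcE /= => /andP[/eqP -> _].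
  have e0' : 0 < complex.Re e by move: e0; rewrite {1}eR ltcR.
  have [y Dy xy] := H _ e0'; exists y; split => //; apply: eB => /=.
  by rewrite eR [`|_|]/(cnorm _)%:C ltcR.
apply: H => e e0.
have /= := cx [set y | cnorm ((x : A) - y) < e].
case => [|y [Dy xy]]; last by exists y.
apply/nbhs_normP; exists e%:C => /=; first by rewrite ltcR.
by move=> y /=; rewrite [`|_|]/(cnorm _)%:C ltcR.
Qed.

Lemma cnorm_complete (u : nat -> A) :
  (forall e : R, 0 < e -> exists N, forall i j,
     (N <= i)%N -> (N <= j)%N -> cnorm (u i - u j) < e) ->
  exists l, forall e : R, 0 < e -> exists N, forall i, (N <= i)%N ->
     cnorm (u i - l) < e.
Proof.
move=> H; pose v : nat -> normed_of A := u.
have reE (e : R[i]) : 0 < e -> e = (complex.Re e)%:C.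
  by case: e => a b; rewrite ltcE /= => /andP[/eqP -> _].
have : cvg (v @ \oo).
  apply: cauchy_cvg; apply: cauchy_exP => e e0.
  have e0' : 0 < complex.Re e by have := e0; rewrite {1}(reE _ e0) ltcR.
  have [N HN] := H _ e0'; exists (v N); rewrite /fmap /=.
  exists N => //= i /= Ni; rewrite -ball_normE /=.
  by rewrite (reE _ e0) [`|_|]/(cnorm _)%:C ltcR; apply: HN.
move=> /cvg_ex[l /cvgrPdist_lt Hl]; exists l => e e0.
have [|N _ HN] := Hl e%:C; first by rewrite ltcR.
exists N => i Ni; have := HN i Ni.
by rewrite /= [`|_|]/(cnorm _)%:C ltcR cnorm_distC.
Qed.

End Topology.

(** * Square roots and positivity *)

Section FunctionalCalculus.
Context {R : realType} {A : cstarAlgType R}.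
Implicit Types a b h s y : A.

Lemma subrBB (x y u : A) : (u - y) - (u - x) = x - y.
Proof. by rewrite opprB [LHS]addrC addrA subrK. Qed.

Lemma half_double a : (2^-1)%:C *: (a + a) = a.
Proof.
rewrite scalerDr -scalerDl -rmorphD /=.
by have -> : 2^-1 + 2^-1 = 1 :> R; [lra | rewrite scale1r].
Qed.

(** For commuting self-adjoint h and s, the element u = h + i s satisfies
star u * u = h * h + s * s, and h is the average of u and star u, which have the
same norm. *)
Lemma cnorm_sum_squares h s : star h = h -> star s = s -> h * s = s * h ->
  cnorm h ^+ 2 <= cnorm (h * h + s * s).
Proof.
move=> sh ss hs; pose u := h + 'i%R *: s.
have su : star u = h - 'i%R *: s.
  by rewrite starD starZ sh ss conjCi scaleNr.
have -> : h * h + s * s = star u * u.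
  rewrite su mulrDr !mulrBl -!scalerAr -!scalerAl scalerA.
  rewrite -(expr2 'i%R) sqrCi.
  by rewrite scaleN1r opprK hs addrA subrK.
rewrite cnorm_starM ler_sqr ?nnegrE ?cnorm_ge0 //.
have -> : h = (2^-1)%:C *: (u + star u).
  by rewrite su addrACA subrr addr0 half_double.
rewrite cnormZr ger0_norm ?invr_ge0 // mulrC ler_pdivrMr //.
by rewrite (le_trans (cnormD _ _)) // cnorm_star; lra.
Qed.

(** Writing the root as 1 - c turns the equation into c = (a + c^2) / 2.  On the
ball of radius r = |a| < 1 the right-hand side is a contraction of ratio r, and
its iterates from 0 are polynomials in a: they are self-adjoint and commute with
everything that commutes with a. *)
Lemma sqrt_one_sub a : star a = a -> cnorm a < 1 ->
  exists s, [/\ star s = s, s * s = 1 - a & forall b, b * a = a * b -> b * s = s * b].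
Proof.
move=> sa a1; set r := cnorm a in a1; have r0 : 0 <= r := cnorm_ge0 a.
pose F x := (2^-1)%:C *: (a + x * x); pose c k := iter k F 0.
have half : `|2^-1 : R| = 2^-1 by rewrite ger0_norm // invr_ge0.
have cr k : cnorm (c k) <= r.
  elim: k => [|k IH]; first by rewrite cnorm0.
  rewrite /= cnormZr half mulrC ler_pdivrMr //.
  have := cnormD a (c k * c k); have := cnormM (c k) (c k).
  have := cnorm_ge0 (c k); rewrite -/r; nra.
have F_lip (x y : A) : cnorm x <= r -> cnorm y <= r -> cnorm (F x - F y) <= r * cnorm (x - y).
  move=> xr yr; rewrite -scalerBr cnormZr half mulrC ler_pdivrMr //.
  have -> : a + x * x - (a + y * y) = x * (x - y) + (x - y) * y.
    by rewrite opprD addrACA subrr add0r mulrBr mulrBl addrA subrK.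
  have := cnormD (x * (x - y)) ((x - y) * y).
  have := cnormM x (x - y); have := cnormM (x - y) y.
  by have := cnorm_ge0 (x - y); nra.
have c_cauchy i k : cnorm (c (k + i)%N - c k) <= r ^+ k * r.
  elim: k => [|k IH]; first by rewrite expr0 mul1r subr0.
  rewrite addSn /= (le_trans (F_lip _ _ (cr _) (cr _))) // exprS -mulrA.
  exact: ler_wpM2l.
have [l cl] : exists l, forall e : R, 0 < e -> exists N, forall i, (N <= i)%N ->
     cnorm (c i - l) < e.
  apply: cnorm_complete => e e0.
  have rlt1 : `|r| < 1 by rewrite ger0_norm.
  have /cvgrPdist_lt/(_ (e / 2)) [|N _ HN] := cvg_expr rlt1.
    by rewrite divr_gt0.
  have small i : (N <= i)%N -> cnorm (c i - c N) < e / 2.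
    move=> /subnKC <-; apply: (le_lt_trans (c_cauchy _ _)).
    have := HN N (leqnn _); rewrite /= sub0r normrN ger0_norm ?exprn_ge0 //.
    by apply: le_lt_trans; rewrite ler_piMr ?exprn_ge0 // ltW.
  exists N => i j /small Hi /small Hj.
  have -> : c i - c j = (c i - c N) - (c j - c N) by rewrite opprB addrA subrK.
  by apply: (le_lt_trans (cnormB _ _)); lra.
have lim0 (x : A) (C : R) : 0 <= C -> (forall k, cnorm x <= C * cnorm (c k - l)) -> x = 0.
  move=> C0 H; apply: (cnorm_eq0_lim (C := C)) => e /cl[N /(_ _ (leqnn _)) He].
  by apply: (le_trans (H N)); apply: ler_wpM2l => //; apply: ltW.
have lr : cnorm l <= r.
  apply/ler_addgt0Pr => e /cl[N /(_ _ (leqnn _)) He].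
  have := cnormB (c N) (c N - l); rewrite subKr; have := cr N; lra.
have sl : star l = l.
  have sc k : star (c k) = c k.
    by elim: k => [|k IH]; rewrite /= ?star0 // starZr starD sa starM !IH.
  apply/subr0_eq; apply: (@lim0 _ 2) => // k.
  have -> : star l - l = (c k - l) - star (c k - l).
    by rewrite starB sc subrBB.
  by rewrite (le_trans (cnormB _ _)) // cnorm_star; lra.
have lfix : F l = l.
  apply/subr0_eq; apply: (cnorm_eq0_lim (C := 2)) => e /cl[N HN].
  have -> : F l - l = (F l - F (c N)) + (c N.+1 - l) by rewrite addrA subrK.
  rewrite (le_trans (cnormD _ _)) //.
  have := F_lip _ _ lr (cr N); rewrite (cnorm_distC l).
  have := HN N (leqnn _); have := HN N.+1 (leqnSn _).
  by have := cnorm_ge0 (c N - l); nra.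
have lcomm b : b * a = a * b -> b * l = l * b.
  move=> ba; have bc k : b * c k = c k * b.
    elim: k => [|k IH]; rewrite /= ?mulr0 ?mul0r //.
    by rewrite -scalerAr -scalerAl mulrDr mulrDl ba mulrA IH -mulrA IH mulrA.
  apply/subr0_eq; apply: (@lim0 _ (2 * cnorm b)) => [|k].
    by rewrite mulr_ge0 // cnorm_ge0.
  have -> : b * l - l * b = (c k - l) * b - b * (c k - l).
    by rewrite mulrBr mulrBl bc subrBB.
  rewrite (le_trans (cnormB _ _)) //.
  by have := cnormM (c k - l) b; have := cnormM b (c k - l); lra.
exists (1 - l); split; first by rewrite starB star1 sl.
  have -> : a = l + l - l * l.
    by rewrite -{1 2}lfix /F -scalerDr half_double addrK.
  by rewrite mulrBr mulr1 mulrBl mul1r !opprB opprD !addrA [1 - l + _]addrAC.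
by move=> b /lcomm bl; rewrite mulrBr mulrBl bl mulr1 mul1r.
Qed.

(** The first bound says that y is positive, the second that - y is.  For each
e > 0, e + y and e - y are then squares of commuting self-adjoint elements, so
e^2 - y^2 is the square of a self-adjoint element commuting with y, and
[cnorm_sum_squares] bounds y by e. *)
Lemma cone_antisym y (t c : R) : star y = y ->
  cnorm (t%:C *: 1 - y) <= t -> cnorm (c%:C *: 1 + y) <= c -> y = 0.
Proof.
move=> sy yt yc; apply: (cnorm_eq0_lim (C := 1)) => e e0; rewrite mul1r.
(* e + w is a multiple of 1 - b with b of norm at most q / (q + e) < 1. *)
have root (w : A) (q : R) : star w = w -> cnorm (q%:C *: 1 - w) <= q ->
  exists s, [/\ star s = s, e%:C *: 1 + w = s * s &
                forall b, b * w = w * b -> b * s = s * b].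
  move=> sw wq; have q0 : 0 <= q := le_trans (cnorm_ge0 _) wq.
  have qe : 0 < q + e by lra.
  pose b := (q + e)^-1%:C *: (q%:C *: 1 - w).
  have [||s [ss s2 sb]] := @sqrt_one_sub b.
  - by rewrite starZr starB starZr star1 sw.
  - rewrite cnormZr ger0_norm ?invr_ge0 1?ltW // mulrC ltr_pdivrMr //; lra.
  exists ((Num.sqrt (q + e))%:C *: s); split.
  - by rewrite starZr ss.
  - rewrite -scalerAr -scalerAl scalerA -rmorphM -expr2 sqr_sqrtr 1?ltW // s2.
    rewrite /b scalerBr scalerA -rmorphM divff ?gt_eqF // scale1r opprB.
    by rewrite addrCA -scalerBl -rmorphB /= addrAC subrr add0r addrC.
  - move=> x xw; rewrite -scalerAr -scalerAl sb // /b -scalerAr -scalerAl.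
    by rewrite mulrBr mulrBl -scalerAr -scalerAl mulr1 mul1r xw.
have [s [ss s2 sb]] := root y t sy yt.
have [||v [sv v2 vb]] := root (- y) c; first by rewrite starN sy.
  by rewrite opprK.
have ys : y * s = s * y by apply: sb.
have yv : y * v = v * y by apply: vb; rewrite mulrN mulNr.
have vs : v * s = s * v by apply/esym/vb; rewrite mulrN mulNr ys.
have := @cnorm_sum_squares y (s * v) sy.
rewrite starM sv ss vs mulrA ys -mulrA yv mulrA => /(_ erefl erefl).
have -> : y * y + s * v * (s * v) = (e ^+ 2)%:C *: 1.
  have -> : s * v * (s * v) = s * s * (v * v) by rewrite -!mulrA (mulrA v s) vs !mulrA.
  rewrite -s2 -v2 mulrDl !mulrDr -!scalerAl -!scalerAr !mul1r !mulr1 !mulrN scalerA.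
  by rewrite -rmorphM -(expr2 e) scalerN [LHS]addrC addrA !subrK.
rewrite cnormZr normrX (gtr0_norm e0) => H.
have c1 : cnorm (1 : A) <= 1 by apply: cnorm_proj; rewrite star1 mulr1.
by have := cnorm_ge0 y; have := cnorm_ge0 (1 : A); nra.
Qed.

End FunctionalCalculus.

(** * Contractivity of *-morphisms *)

Section Morphisms.
Context {R : realType} {A B : cstarAlgType R} {f : A -> B}.
Context (fmor : star_morphism f).

Lemma star_morphismM : {morph f : x y / x * y}.
Proof. by case: fmor. Qed.

Lemma star_morphism_star : {morph f : x / star x}.
Proof. by case: fmor. Qed.

Lemma star_morphismD : {morph f : x y / x + y}.
Proof. by case: fmor => H _ _ x y; have := H 1 x y; rewrite !scale1r. Qed.

Lemma star_morphism0 : f 0 = 0.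
Proof. by apply: (addrI (f 0)); rewrite -star_morphismD !addr0. Qed.

Lemma star_morphismZ (a : R[i]) x : f (a *: x) = a *: f x.
Proof. by case: fmor => H _ _; rewrite -[a *: x]addr0 H star_morphism0 addr0. Qed.

Lemma star_morphismB : {morph f : x y / x - y}.
Proof. by move=> x y; rewrite -scaleN1r star_morphismD star_morphismZ scaleN1r. Qed.

Lemma star_morphismX x k : f (x ^+ k.+1) = f x ^+ k.+1.
Proof. by elim: k => [//|k IH]; rewrite exprS star_morphismM IH -exprS. Qed.

(** For self-adjoint h of norm less than 1 there is s with h^2 + s^2 = 1
commuting with h.  Then (f h)^2 + (f s)^2 = f 1 is a projection, of norm at
most 1, and [cnorm_sum_squares] applies.  The general case follows by scaling
and the C*-identity. *)
Lemma star_morphism_contractive x : cnorm (f x) <= cnorm x.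
Proof.
have unit_ball h : star h = h -> cnorm h < 1 -> cnorm (f h) <= 1.
  move=> sh h1; have [||s [ss s2 sb]] := @sqrt_one_sub R A (h * h).
  - by rewrite starM sh.
  - by have := cnormM h h; have := cnorm_ge0 h; nra.
  have hs : h * s = s * h by apply: sb; rewrite mulrA.
  have := @cnorm_sum_squares R B (f h) (f s).
  rewrite -!star_morphism_star sh ss -!star_morphismM hs -star_morphismD s2.
  rewrite addrC subrK => /(_ erefl erefl erefl).
  have : cnorm (f 1) <= 1.
    by apply: cnorm_proj; rewrite -star_morphism_star -star_morphismM star1 mulr1.
  by have := cnorm_ge0 (f h); nra.
have sa h : star h = h -> cnorm (f h) <= cnorm h.
  move=> sh; apply/ler_addgt0Pr => e e0.
  have he : 0 < cnorm h + e by have := cnorm_ge0 h; lra.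
  have := unit_ball ((cnorm h + e)^-1%:C *: h).
  have -> : cnorm ((cnorm h + e)^-1%:C *: h) = (cnorm h + e)^-1 * cnorm h.
    by rewrite cnormZr gtr0_norm ?invr_gt0.
  rewrite starZr sh star_morphismZ cnormZr gtr0_norm ?invr_gt0 //.
  by rewrite !ler_pdivrMl // ltr_pdivrMl // mulr1; apply => //; rewrite ltrDl.
have := sa (star x * x); rewrite starM starK => /(_ erefl).
rewrite star_morphismM star_morphism_star !cnorm_starM.
by rewrite ler_sqr ?nnegrE ?cnorm_ge0.
Qed.

End Morphisms.

(** * Cuntz families *)

Section Orthogonality.
Context {R : realType} {A : cstarAlgType R}.

Lemma cnorm1_le : cnorm (1 : A) <= 1.
Proof. by apply: cnorm_proj; rewrite star1 mulr1. Qed.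

Lemma cnorm_isometry (v : A) : star v * v = 1 -> cnorm v <= 1.
Proof. by move=> vi; apply: cnorm_le1_star; rewrite vi cnorm1_le. Qed.

Lemma cnorm_sum (I : Type) (r : seq I) (P : pred I) (F : I -> A) :
  cnorm (\sum_(i <- r | P i) F i) <= \sum_(i <- r | P i) cnorm (F i).
Proof.
elim/big_rec2: _ => [|i x y _ IH]; first by rewrite cnorm0.
by rewrite (le_trans (cnormD _ _)) // lerD2l.
Qed.

(** Compressing the sum of the range projections by V j, whose own term gives 1,
shows that the positive elements y i = star (x i) * x i, x i = star (V i) * V j,
i <> j, sum to 0.  So y k and - y k are both positive in the sense of
[cone_antisym]: each y i is within 1/2 of 1/2, because 1 - 2 p is unitary for a
projection p. *)
Lemma isometries_orthogonal (I : finType) (V : I -> A) :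
  (forall i, star (V i) * V i = 1) -> \sum_i V i * star (V i) = 1 ->
  forall k j, k != j -> star (V k) * V j = 0.
Proof.
move=> Viso Vsum k j kj; pose x i := star (V i) * V j.
pose y i := star (x i) * x i; pose h : A := (2^-1)%:C *: 1.
have starVj : cnorm (star (V j)) <= 1 by rewrite cnorm_star cnorm_isometry.
have yE i : y i = star (V j) * (V i * star (V i)) * V j.
  by rewrite /y /x starM starK !mulrA.
have y_half i : cnorm (h - y i) <= 2^-1.
  pose p := V i * star (V i).
  have pp : p * p = p by rewrite /p mulrA -(mulrA _ (star _)) Viso mulr1.
  have sp : star p = p by rewrite starM starK.
  have u1 : cnorm (1 - (p + p)) <= 1.
    apply: cnorm_le1_star; rewrite starB star1 starD sp.
    suff -> : (1 - (p + p)) * (1 - (p + p)) = 1 by exact: cnorm1_le.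
    rewrite mulrBr mulr1 mulrBl mul1r mulrDl !mulrDr !pp.
    by rewrite opprB addrK subrK.
  have -> : h - y i = (2^-1)%:C *: (star (V j) * (1 - (p + p)) * V j).
    rewrite mulrBr mulr1 mulrBl (Viso j) scalerBr mulrDr mulrDl half_double.
    by rewrite yE.
  rewrite cnormZr ger0_norm ?invr_ge0 // ler_piMr ?invr_ge0 //.
  have := cnormM (star (V j) * (1 - (p + p))) (V j).
  have := cnormM (star (V j)) (1 - (p + p)); have := cnorm_isometry (Viso j).
  have := cnorm_ge0 (star (V j) * (1 - (p + p))).
  have := cnorm_ge0 (star (V j)); have := cnorm_ge0 (1 - (p + p)).
  by have := cnorm_ge0 (V j); nra.
have ysum : \sum_(i | i != j) y i = 0.
  have : \sum_i y i = 1.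
    under eq_bigr do rewrite yE.
    by rewrite -mulr_suml -mulr_sumr Vsum mulr1 Viso.
  have yj : y j = 1 by rewrite /y /x Viso star1 mulr1.
  by rewrite (bigD1 j) //= yj => /eqP; rewrite -subr_eq0 addrAC subrr add0r => /eqP.
apply: star_mul_eq0; rewrite -/(x k) -/(y k).
apply: (@cone_antisym R A _ 2^-1 (\sum_(i | (i != j) && (i != k)) 2^-1)).
- by rewrite /y starM starK.
- exact: y_half.
have -> : y k = - \sum_(i | (i != j) && (i != k)) y i.
  by apply/eqP; rewrite -addr_eq0; move: ysum; rewrite (bigD1 k) //= => ->.
rewrite rmorph_sum scaler_suml -sumrB (le_trans (cnorm_sum _ _ _)) //.
by apply: ler_sum => i _; exact: y_half.
Qed.

Definition cuntz_family (I : finType) (V : I -> A) : Prop :=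
  (forall i j, star (V i) * V j = (i == j)%:R) /\ \sum_i V i * star (V i) = 1.

Lemma cuntz_family_prod (I J : finType) (V : I -> A) (U : J -> A) :
  cuntz_family V -> cuntz_family U ->
  cuntz_family (fun p : I * J => V p.1 * U p.2).
Proof.
move=> [Vo Vs] [Uo Us]; split=> [[i k] [j l]|] /=.
  rewrite starM mulrA -(mulrA (star (U k))) Vo xpair_eqE.
  by have [_|_] /= := eqVneq i j; rewrite ?mulr0 ?mul0r // mulr1 Uo.
rewrite -(pair_bigA _ (fun i k => V i * U k * star (V i * U k))) /=.
rewrite -[RHS]Vs; apply: eq_bigr => i _.
under eq_bigr do rewrite starM -mulrA (mulrA (U _)).
by rewrite -mulr_sumr -mulr_suml Us mul1r.
Qed.

(** Products of k members of a Cuntz family form a Cuntz family again, and the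
size grows because it is at least 2 at the start.  The result is indexed by
natural numbers so that initial segments of it can be used. *)
Lemma large_cuntz_family (I : finType) (V : I -> A) (k : nat) :
  (1 < #|I|)%N -> cuntz_family V ->
  exists2 N, (k <= N)%N & exists W : nat -> A,
    cuntz_family (fun i : 'I_N => W i).
Proof.
move=> I2 cV.
have [J [kJ [W [Wo Ws]]]] : exists J : finType, (k < #|J|)%N /\
    exists W : J -> A, cuntz_family W.
  elim: k => [|k [J [kJ [W cW]]]].
    exists unit; rewrite card_unit; split=> //; exists (fun=> 1); split.
      by case=> [] []; rewrite star1 mulr1.
    by rewrite (bigD1 tt) //= big1 => [|[]] //; rewrite star1 mulr1 addr0.
  exists (J * I)%type; split; last by eexists; apply: cuntz_family_prod cW cV.
  by rewrite card_prod; nia.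
exists #|J|; first exact: ltnW.
exists (fun i => if insub i is Some j then W (@enum_val J J j) else 0).
split=> [i j|]; first by rewrite !valK Wo (inj_eq enum_val_inj).
under eq_bigr do rewrite valK.
by rewrite -[RHS]Ws [RHS](reindex _ (onW_bij _ (@enum_val_bij J))).
Qed.

End Orthogonality.

(** * The defining relations, in a corner *)

Section Unitary.
Context {R : realType} {A : cstarAlgType R}.

Lemma expr_unitary (u : A) k : unitary u -> unitary (u ^+ k).
Proof.
case=> u1 u2; elim: k => [|k [IH1 IH2]].
  by split; rewrite !expr0 star1 mulr1.
split; first by rewrite exprS starM -mulrA (mulrA (star u)) u1 mul1r.
by rewrite exprSr starM -mulrA (mulrA u) u2 mul1r.
Qed.

End Unitary.

Section CornerRepresentations.
Context {R : realType}.

(** The relations of O_(m,n)(T) for the pair (z, S 1), relative to the unit P of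
the corner P A P.  Working in corners allows representations on orthogonal
projections to be added up, see [corner_rep_add]. *)
Definition corner_rep (m n : nat) (A : cstarAlgType R) (P w s : A) : Prop :=
  [/\ star w * w = P /\ w * star w = P, star s * s = P, w ^+ n * s = s * w ^+ m,
      \sum_(i < n) w ^+ i * s * star (w ^+ i * s) = P &
      [/\ P * w = w, w * P = w, P * s = s & s * P = s]].

Lemma corner_rep_O_relations (m n : nat) (A : cstarAlgType R) (w s : A) : (0 < n)%N ->
  corner_rep m n 1 w s -> O_relations m n w (fun i => w ^+ i.-1 * s).
Proof.
case: n => // n' _ [uw ss rel rsum _]; split => //.
- move=> i _; have [wi _] := expr_unitary i.-1 uw.
  by rewrite /Defs.isometry starM -mulrA (mulrA (star (w ^+ _))) wi mul1r.
- by case=> // i _; rewrite mulrA -exprS.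
- by rewrite /= expr0 mul1r mulrA -exprS rel.
- by rewrite big_add1 /= big_mkord.
Qed.

Lemma O_relations_corner_rep (m n : nat) (A : cstarAlgType R) (z : A) (S : nat -> A) :
  (0 < n)%N -> O_relations m n z S ->
  corner_rep m n 1 z (S 1%N) /\ (forall i, (1 <= i <= n)%N -> S i = z ^+ i.-1 * S 1%N).
Proof.
case: n => // n' _ [uz Siso zS zSn Ssum].
have SE i : (1 <= i <= n'.+1)%N -> S i = z ^+ i.-1 * S 1%N.
  case: i => // i; rewrite ltnS; elim: i => [|i IH] lti.
    by rewrite mul1r.
  by rewrite -(zS i.+1) ?IH ?mulrA -?exprS //; apply: ltnW.
split=> //; split=> //.
- by apply: Siso; rewrite leqnn.
- by rewrite -zSn (SE n'.+1) ?leqnn // mulrA -exprS.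
- move: Ssum; rewrite big_add1 big_mkord /= => <-.
  by apply: eq_bigr => i _; rewrite (SE i.+1) /=.
- by rewrite !mul1r !mulr1.
Qed.

Lemma corner_rep_image (m n : nat) (A B : cstarAlgType R) (f : B -> A) (z s : B) :
  star_morphism f -> (0 < m)%N -> (0 < n)%N -> corner_rep m n 1 z s ->
  corner_rep m n (f 1) (f z) (f s).
Proof.
case: m n => [//|m'] [//|n'] fmor _ _ [[z1 z2] ss rel rsum _]; split.
- by rewrite -(star_morphism_star fmor) -!(star_morphismM fmor) z1 z2.
- by rewrite -(star_morphism_star fmor) -!(star_morphismM fmor) ss.
- by rewrite -!(star_morphismX fmor) -!(star_morphismM fmor) rel.
- rewrite -rsum (big_morph f (star_morphismD fmor) (star_morphism0 fmor)).
  apply: eq_bigr => -[[|i] _] _ /=.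
    by rewrite !mul1r (star_morphismM fmor) (star_morphism_star fmor).
  rewrite -(star_morphismX fmor) (star_morphismM fmor) (star_morphism_star fmor).
  by rewrite (star_morphismM fmor).
- by rewrite -!(star_morphismM fmor) !mul1r !mulr1.
Qed.

Lemma corner_rep_add (m n : nat) (A : cstarAlgType R) (P Q w1 w2 s1 s2 : A) :
  P * Q = 0 -> Q * P = 0 -> star P = P -> star Q = Q ->
  corner_rep m n P w1 s1 -> corner_rep m n Q w2 s2 ->
  corner_rep m n (P + Q) (w1 + w2) (s1 + s2).
Proof.
move=> PQ QP sP sQ [[w1a w1b] s1a r1 sum1 [Pw1 w1P Ps1 s1P]]
  [[w2a w2b] s2a r2 sum2 [Qw2 w2Q Qs2 s2Q]].
pose corner X x := X * x = x /\ x * X = x :> A.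
have cornerM X x y : corner X x -> corner X y -> corner X (x * y).
  by move=> [Xx _] [_ yX]; split; rewrite ?mulrA ?Xx // -mulrA yX.
have corner_star X x : star X = X -> corner X x -> corner X (star x).
  by move=> sX [Xx xX]; split; rewrite -{1}sX -starM ?xX ?Xx.
have mulDD x x' y y' : corner P x -> corner P x' -> corner Q y -> corner Q y' ->
    (x + y) * (x' + y') = x * x' + y * y'.
  move=> [_ xP] [Px' _] [_ yQ] [Qy' _]; rewrite mulrDl !mulrDr.
  have -> : x * y' = 0 by rewrite -xP -Qy' mulrA -(mulrA x) PQ mulr0 mul0r.
  have -> : y * x' = 0 by rewrite -yQ -Px' mulrA -(mulrA y) QP mulr0 mul0r.
  by rewrite addr0 add0r.
have cw1 : corner P w1 by []. have cw2 : corner Q w2 by [].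
have cs1 : corner P s1 by []. have cs2 : corner Q s2 by [].
have cP : corner P P by rewrite -{2}w1a; apply: cornerM; [apply: corner_star|].
have cQ : corner Q Q by rewrite -{2}w2a; apply: cornerM; [apply: corner_star|].
have cornerXl X w s i : corner X w -> corner X s -> corner X (w ^+ i * s).
  move=> cw cs; elim: i => [|i IH]; first by rewrite mul1r.
  by rewrite exprS -mulrA; apply: cornerM.
have cornerXr X w s i : corner X w -> corner X s -> corner X (s * w ^+ i).
  move=> cw cs; elim: i => [|i IH]; first by rewrite mulr1.
  by rewrite exprSr mulrA; apply: cornerM.
have powl i : (w1 + w2) ^+ i * (s1 + s2) = w1 ^+ i * s1 + w2 ^+ i * s2.
  elim: i => [|i IH]; first by rewrite !expr0 !mul1r.
  by rewrite exprS -mulrA IH mulDD ?mulrA -?exprS //; apply: cornerXl.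
have powr i : (s1 + s2) * (w1 + w2) ^+ i = s1 * w1 ^+ i + s2 * w2 ^+ i.
  elim: i => [|i IH]; first by rewrite !expr0 !mulr1.
  by rewrite exprSr mulrA IH mulDD -?mulrA -?exprSr //; apply: cornerXr.
split.
- by rewrite starD !mulDD ?w1a ?w1b ?w2a ?w2b //; apply: corner_star.
- by rewrite starD mulDD ?s1a ?s2a //; apply: corner_star.
- by rewrite powl powr r1 r2.
- rewrite -[in RHS]sum1 -sum2 -big_split; apply: eq_bigr => i _ /=.
  by rewrite powl starD mulDD //; do ?apply: corner_star => //; apply: cornerXl.
- by rewrite !mulDD // Pw1 Qw2 w1P w2Q Ps1 Qs2 s1P s2Q.
Qed.

Lemma eqn_modM_coprime (a d q q' : nat) : coprime a d -> (q < d)%N -> (q' < d)%N ->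
  (a * q == a * q' %[mod d])%N = (q == q').
Proof.
move=> ad qd q'd; apply/idP/idP => [|/eqP-> //] E.
wlog le_q : q q' qd q'd E / (q <= q')%N => [wl|].
  have [|/ltnW] := leqP q q' => le_q; first exact: wl.
  by rewrite eq_sym; apply: wl => //; rewrite eq_sym.
move: E; rewrite eq_sym eqn_mod_dvd ?leq_mul // -mulnBr Gauss_dvdr 1?coprime_sym //.
by rewrite -eqn_mod_dvd // !modn_small // eq_sym.
Qed.

(** Multiplication by a number coprime to N permutes the residues modulo N. *)
Lemma sum_residues (V : nmodType) (G : nat -> V) (a b N : nat) :
  coprime a N -> \sum_(q < N) G ((a * q + b) %% N)%N = \sum_(q < N) G q.
Proof.
case: N => [|N] aN; first by rewrite !big_ord0.
pose h (q : 'I_N.+1) : 'I_N.+1 := inord ((a * q + b) %% N.+1).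
have hE q : h q = ((a * q + b) %% N.+1)%N :> nat by rewrite inordK // ltn_pmod.
rewrite [RHS](reindex_inj (h := h)) => [|q q' /(congr1 val)].
  by apply: eq_bigr => q _; rewrite hE.
rewrite /= !hE => /eqP; rewrite eqn_modDr => E; apply: val_inj => /=.
by move: E; rewrite eqn_modM_coprime ?ltn_ord // => /eqP.
Qed.

Lemma corner_rep_relX (m n : nat) (A : cstarAlgType R) (P w s : A) k :
  corner_rep m n P w s -> w ^+ (n * k) * s = s * w ^+ (m * k).
Proof.
case=> _ _ rel _ _; elim: k => [|k IH]; first by rewrite !muln0 mul1r mulr1.
by rewrite !mulnS !exprD -mulrA IH mulrA rel mulrA.
Qed.

(** Since z^n s = s z^m, the projection z^k s star (z^k s) depends only on k
modulo n, and k |-> d k permutes the residues modulo n. *)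
Lemma corner_rep_expr (m n : nat) (A : cstarAlgType R) (z s : A) (d : nat) :
  (0 < n)%N -> coprime d n -> corner_rep m n 1 z s -> corner_rep m n 1 (z ^+ d) s.
Proof.
move=> n0 dn zs; have [uz ss rel zsum _] := zs.
have uzX k : unitary (z ^+ k) by apply: expr_unitary.
split=> //; first exact: uzX.
- by rewrite -!exprM mulnC (corner_rep_relX _ zs) mulnC.
- pose G k := z ^+ k * s * star (z ^+ k * s).
  have G_mod k : G k = G (k %% n)%N.
    have E : z ^+ k * s = z ^+ (k %% n) * s * z ^+ (m * (k %/ n)).
      rewrite -mulrA -(corner_rep_relX _ zs) mulrA -exprD addnC mulnC.
      by rewrite -divn_eq.
    rewrite /G E.
    by rewrite starM -mulrA (mulrA (_ ^+ (m * _))) (uzX _).2 mul1r.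
  rewrite -zsum -(sum_residues G 0 dn); apply: eq_bigr => i _.
  by rewrite addn0 -G_mod /G exprM.
- by rewrite !mul1r !mulr1.
Qed.

End CornerRepresentations.

(** * Adjoining a d-th root of z *)

Section Blocks.

Lemma sum_blocks (V : nmodType) (H : nat -> V) (n d : nat) :
  \sum_(q < d) \sum_(i < n) H (n * q + i)%N = \sum_(j < d) \sum_(i < n) H (d * i + j)%N.
Proof.
have blocks a b : \sum_(0 <= k < a * b) H k = \sum_(q < a) \sum_(i < b) H (b * q + i)%N.
  rewrite big_nat_mul big_mkord; apply: eq_bigr => q _.
  rewrite -{1}[(q * b)%N]add0n big_addn mulSn addnK big_mkord.
  by apply: eq_bigr => i _; rewrite addnC mulnC.
by rewrite -blocks mulnC blocks exchange_big.
Qed.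

End Blocks.

Section RootExtension.
Context {R : realType} (m n d N : nat) (A : cstarAlgType R) (z s : A) (V : nat -> A).
Context (zs : corner_rep m n 1 z s) (n0 : (0 < n)%N) (m0 : (0 < m)%N).
Context (d0 : (0 < d)%N) (dN : (d <= N)%N) (md : coprime m d) (nd : coprime n d).
Context (cV : cuntz_family (fun i : 'I_N => V i)).

Let uz k : unitary (z ^+ k).
Proof. by apply: expr_unitary; case: zs. Qed.

Let V_orth i j : (i < N)%N -> (j < N)%N -> star (V i) * V j = (i == j)%:R.
Proof. by move=> iN jN; have [H _] := cV; rewrite (H (Ordinal iN) (Ordinal jN)). Qed.

Let modN k : (k %% d < N)%N. Proof. by apply: leq_trans dN; rewrite ltn_pmod. Qed.

(** Think of v_k as the vector z^(k/d): the V_i with i < d are the powers of the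
root below z, and d steps multiply by z.  The definition is locked because the
product in it would otherwise be exposed by rewriting with associativity. *)
Definition cycle_vec (k : nat) : A := locked (V (k %% d)%N * z ^+ (k %/ d)).
Local Notation v := cycle_vec.

Lemma cycleE k : v k = V (k %% d)%N * z ^+ (k %/ d).
Proof. by rewrite /cycle_vec -lock. Qed.

Lemma cycle_isometry k : star (v k) * v k = 1.
Proof.
by rewrite cycleE starM -mulrA (mulrA (star (V _))) V_orth // eqxx mul1r (uz _).1.
Qed.

Lemma cycle_orth j k : (j != k %[mod d])%N -> star (v j) * v k = 0.
Proof.
move=> jk; rewrite !cycleE starM -mulrA (mulrA (star (V _))) V_orth //.
by rewrite (negbTE jk) mul0r mulr0.
Qed.

Lemma cycle_proj k : v k * star (v k) = V (k %% d)%N * star (V (k %% d)%N).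
Proof. by rewrite cycleE starM -mulrA (mulrA (z ^+ _)) (uz _).2 mul1r. Qed.

Lemma cycle_shift k a : v (k + d * a) = v k * z ^+ a.
Proof. by rewrite !cycleE addnC (mulnC d) modnMDl divnMDl // addnC exprD mulrA. Qed.

Lemma cycle_outside i k : (d <= i < N)%N -> star (V i) * v k = 0.
Proof.
case/andP=> di iN; rewrite cycleE mulrA V_orth //.
by rewrite gtn_eqF ?mul0r // (leq_trans _ di) // ltn_pmod.
Qed.

Lemma cycle_block i j : (j < d)%N -> v (d * i + j) = V j * z ^+ i.
Proof.
by move=> jd; rewrite addnC cycle_shift cycleE modn_small // divn_small // mulr1.
Qed.

Let P : A := \sum_(k < d) V k * star (V k).

Lemma cycle_frame a b : coprime a d -> \sum_(q < d) v (a * q + b) * star (v (a * q + b)) = P.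
Proof.
move=> ad; under eq_bigr do rewrite cycle_proj.
exact: (sum_residues (fun k => V k * star (V k)) b ad).
Qed.

Lemma cycle_orthM a b q q' : coprime a d -> (q < d)%N -> (q' < d)%N ->
  star (v (a * q + b)) * v (a * q' + b) = (q == q')%:R.
Proof.
move=> ad qd q'd; have [->|qq'] := eqVneq; first by rewrite cycle_isometry.
by rewrite cycle_orth // eqn_modDr eqn_modM_coprime.
Qed.

Lemma cycle_projl k : P * v k = v k.
Proof.
rewrite /P mulr_suml (bigD1 (Ordinal (ltn_pmod k d0))) //= big1 => [|i ik].
  by rewrite addr0 -cycle_proj -mulrA cycle_isometry mulr1.
rewrite cycleE -mulrA (mulrA (star _)) V_orth // ?(leq_trans _ dN) //.
by rewrite (negbTE (_ : i != k %% d :> nat)%N) // mul0r mulr0.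
Qed.

Lemma star_P : star P = P.
Proof. by rewrite star_sum; apply: eq_bigr => i _; rewrite starM starK. Qed.

(** For a coprime to d, the v_(a q) with q < d form an orthonormal basis of the
span of V_0, ..., V_(d - 1); this operator sends v_(a q) to x q. *)
Definition frame_op (a : nat) (x : nat -> A) : A :=
  \sum_(q < d) x q * star (v (a * q)).

(** Beyond q < d the formula persists as soon as x respects the translation
v_(a (q + d)) = v_(a q) z^a. *)
Lemma frame_op_cycle a x q : coprime a d -> (forall q, x (q + d)%N = x q * z ^+ a) ->
  frame_op a x * v (a * q) = x q.
Proof.
move=> ad xd.
have xE k r : x (r + d * k)%N = x r * z ^+ (a * k).
  elim: k => [|k IH]; first by rewrite !muln0 addn0 mulr1.
  by rewrite mulnS addnCA addnC xd IH mulnS addnC exprD mulrA.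
rewrite {1}(divn_eq q d) addnC (mulnC (q %/ d)%N) mulnDr mulnCA cycle_shift.
rewrite [RHS](_ : _ = x (q %% d)%N * z ^+ (a * (q %/ d))); last first.
  by rewrite -xE mulnC addnC -divn_eq.
rewrite mulrA; congr (_ * _); rewrite /frame_op mulr_suml.
rewrite (bigD1 (Ordinal (ltn_pmod q d0))) //= big1 => [|i iq].
  by rewrite addr0 -mulrA cycle_isometry mulr1.
rewrite -mulrA -[(a * i)%N]addn0 -[(a * (q %% d))%N]addn0 cycle_orthM ?ltn_pmod //.
by rewrite (negbTE (_ : i != q %% d :> nat)%N) // mulr0.
Qed.

Lemma frame_op_projr a x : frame_op a x * P = frame_op a x.
Proof.
rewrite mulr_suml; apply: eq_bigr => q _.
by rewrite -mulrA -{1}star_P -starM cycle_projl.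
Qed.

Lemma frame_op_projl a x : (forall q, P * x q = x q) -> P * frame_op a x = frame_op a x.
Proof. by move=> Px; rewrite mulr_sumr; apply: eq_bigr => q _; rewrite mulrA Px. Qed.

Lemma frame_op_starr a x : coprime a d ->
  frame_op a x * star (frame_op a x) = \sum_(q < d) x q * star (x q).
Proof.
move=> ad; rewrite {1}/frame_op mulr_suml; apply: eq_bigr => q _.
rewrite -mulrA; congr (_ * _); rewrite -starM; congr star.
rewrite /frame_op mulr_suml (bigD1 q) //= big1 => [|i iq].
  by rewrite addr0 -mulrA cycle_isometry mulr1.
by rewrite -mulrA -[(a * i)%N]addn0 -[(a * q)%N]addn0 cycle_orthM // (negbTE (iq : i != q :> nat)) mulr0.
Qed.

Lemma frame_op_starl a x : coprime a d ->
  (forall q q', (q < d)%N -> (q' < d)%N -> star (x q) * x q' = (q == q')%:R) ->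
  star (frame_op a x) * frame_op a x = P.
Proof.
move=> ad xo; rewrite -[RHS](cycle_frame 0 ad) {1}/frame_op star_sum mulr_suml.
apply: eq_bigr => q _; rewrite starM starK -mulrA addn0; congr (_ * _).
rewrite /frame_op mulr_sumr (bigD1 q) //= big1 => [|i iq].
  by rewrite addr0 mulrA xo // eqxx mul1r.
by rewrite mulrA xo // eq_sym (negbTE (iq : i != q :> nat)) mul0r.
Qed.

Lemma cycle_ext a X Y : coprime a d -> X * P = X -> Y * P = Y ->
  (forall q, X * v (a * q) = Y * v (a * q)) -> X = Y.
Proof.
move=> ad XP YP XY; rewrite -XP -YP -(cycle_frame 0 ad) !mulr_sumr.
by apply: eq_bigr => q _; rewrite addn0 !mulrA XY.
Qed.

Let W : A := frame_op 1 (fun q => v q.+1).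
Let T : A := frame_op m (fun q => v (n * q) * s).

Lemma shift_cycle k : W * v k = v k.+1.
Proof.
rewrite -{1}[k]mul1n frame_op_cycle ?coprime1n // => q.
by rewrite -addSn -{1}[d]muln1 cycle_shift.
Qed.

Lemma shiftX_cycle i k : W ^+ i * v k = v (k + i)%N.
Proof.
elim: i => [|i IH]; first by rewrite mul1r addn0.
by rewrite exprS -mulrA IH shift_cycle addnS.
Qed.

Lemma isom_cycle q : T * v (m * q) = v (n * q) * s.
Proof.
rewrite frame_op_cycle // => k.
rewrite mulnDr (mulnC n d) cycle_shift -!mulrA; congr (_ * _).
by have := corner_rep_relX 1 zs; rewrite !muln1.
Qed.

(** The relation w^n t = t w^m is checked on the basis v_(m q): both sides give
v_(n (q + 1)) s.  The range projections of w^i t, i < n, are sums over q < d of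
the projections H k of v_k s with k = n q + i, so together they are all H k with
k < n d; regrouped by k modulo d, they sum to P by the relation for z and s. *)
Lemma cycle_corner_rep : corner_rep m n P W T.
Proof.
have ss : star s * s = 1 by case: zs.
have PW : P * W = W by apply: frame_op_projl => q; rewrite cycle_projl.
have WP : W * P = W by apply: frame_op_projr.
have PT : P * T = T by apply: frame_op_projl => q; rewrite mulrA cycle_projl.
have TP : T * P = T by apply: frame_op_projr.
have TXP i : T * W ^+ i * P = T * W ^+ i.
  by case: i => [|i]; rewrite ?mulr1 // exprSr -!mulrA WP.
split=> //.
- split; last first.
    rewrite frame_op_starr ?coprime1n //.
    rewrite -[RHS](cycle_frame 1 (coprime1n d)).
    by apply: eq_bigr => q _; rewrite mul1n addn1.
  apply: frame_op_starl; rewrite ?coprime1n // => q q' qd q'd.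
  have := cycle_orthM 1 (coprime1n d) qd q'd.
  by rewrite !mul1n !addn1.
- apply: frame_op_starl => // q q' qd q'd.
  rewrite starM -mulrA (mulrA (star (v _))).
  rewrite -[(n * q)%N]addn0 -[(n * q')%N]addn0 cycle_orthM //.
  by have [_|_] := eqVneq; rewrite ?mul1r ?ss // mul0r mulr0.
- apply: (cycle_ext md) => [||q].
  + by rewrite -mulrA TP.
  + exact: TXP.
  + by rewrite -!mulrA shiftX_cycle isom_cycle -mulnSr isom_cycle mulrA shiftX_cycle mulnSr.
- pose H k := v k * s * star (v k * s).
  have WT i : W ^+ i * T = frame_op m (fun q => v (n * q + i) * s).
    rewrite /T /frame_op mulr_sumr; apply: eq_bigr => q _.
    by rewrite !mulrA shiftX_cycle.
  under eq_bigr do rewrite WT frame_op_starr //.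
  rewrite exchange_big /= (sum_blocks H); apply: eq_bigr => j _.
  have [_ _ _ zsum _] := zs.
  rewrite -[X in _ = X * _]mulr1 -zsum mulr_sumr mulr_suml; apply: eq_bigr => i _.
  by rewrite /H cycle_block ?ltn_ord // !starM !mulrA.
Qed.

Let rho (x : A) : A := \sum_(i < N | (d <= i)%N) V i * x * star (V i).

Lemma rho_star_morphism : star_morphism rho.
Proof.
split=> [a x y|x y|x]; rewrite /rho.
- rewrite scaler_sumr -big_split; apply: eq_bigr => i _ /=.
  by rewrite mulrDr mulrDl -scalerAr -scalerAl.
- rewrite mulr_suml; apply: eq_bigr => i di.
  rewrite mulr_sumr (bigD1 i) //= big1 => [|j /andP[_ ji]].
    by rewrite addr0 !mulrA -(mulrA _ (star _)) V_orth // eqxx mulr1.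
  rewrite !mulrA -(mulrA _ (star _)) V_orth //.
  by rewrite [_ == _](negbTE (_ : i != j :> nat)%N) ?mulr0 ?mul0r // eq_sym.
- by rewrite star_sum; apply: eq_bigr => i _; rewrite !starM starK mulrA.
Qed.

Lemma rho_cycle x k : rho x * v k = 0.
Proof.
rewrite mulr_suml big1 // => i di.
by rewrite -mulrA cycle_outside ?mulr0 // di ltn_ord.
Qed.

(** The isometry v0 intertwines (w^d, t) with (z, s).  The adjoint of t is
treated explicitly because the intertwining by t does not imply it. *)
Lemma root_extension : exists w t v0 : A,
  [/\ corner_rep m n 1 w t, star v0 * v0 = 1, w ^+ d * v0 = v0 * z,
      t * v0 = v0 * s & star t * v0 = v0 * star s].
Proof.
pose v0 := v 0; exists (W + rho z), (T + rho s), v0.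
have rhoP x : rho x * P = 0.
  by rewrite -(cycle_frame 0 md) mulr_sumr big1 // => q _; rewrite mulrA rho_cycle mul0r.
have star_rho1 : star (rho 1) = rho 1.
  by rewrite -(star_morphism_star rho_star_morphism) star1.
have Prho : P * rho 1 = 0.
  by rewrite -[LHS]starK starM star_rho1 star_P rhoP star0.
split.
- have -> : 1 = P + rho 1.
    have [_ Vsum] := cV; rewrite -[LHS]Vsum (bigID (fun i : 'I_N => (i < d)%N)) /=.
    congr (_ + _).
      exact/esym/(big_ord_widen N (fun k => V k * star (V k)) dN).
    by apply: eq_big => i; [rewrite -leqNgt | rewrite mulr1].
  apply: corner_rep_add => //; first exact: star_P.
    exact: cycle_corner_rep.
  exact: corner_rep_image rho_star_morphism _ _ zs.
- exact: cycle_isometry.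
- have wX i : (W + rho z) ^+ i * v0 = v i.
    elim: i => [|i IH]; first by rewrite mul1r.
    by rewrite exprS -mulrA IH mulrDl rho_cycle addr0 shift_cycle.
  by rewrite wX -[d]muln1 -[X in v X]add0n cycle_shift.
- rewrite mulrDl rho_cycle addr0.
  by have := isom_cycle 0; rewrite !muln0.
- rewrite starD mulrDl -(star_morphism_star rho_star_morphism) rho_cycle addr0.
  rewrite /T /frame_op star_sum mulr_suml (bigD1 (Ordinal d0)) //= big1 => [|q q0].
    by rewrite !muln0 addr0 !starM starK -mulrA -(mulrA (star s)) cycle_isometry mulr1.
  rewrite !starM starK -!mulrA cycle_orth ?mulr0 //.
  by rewrite -{1}(muln0 n) eqn_modM_coprime.
Qed.

End RootExtension.

(** * C*-subalgebras *)

Section Subalgebras.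
Context {R : realType}.
Implicit Types A B : cstarAlgType R.

Lemma cstar_gen_subalgebra A (X : set A) : cstar_subalgebra (cstar_gen X).
Proof.
split.
- by apply: closed_bigI => D [[cD]].
- by move=> D [[]].
- move=> a x y Dx Dy D DX; have [[_ _ Dlin _ _] _] := DX.
  by apply: Dlin; [exact: Dx | exact: Dy].
- move=> x y Dx Dy D DX; have [[_ _ _ DM _] _] := DX.
  by apply: DM; [exact: Dx | exact: Dy].
- move=> x Dx D DX; have [[_ _ _ _ Dstar] _] := DX.
  by apply: Dstar; exact: Dx.
Qed.

Lemma sub_cstar_gen A (X : set A) : X `<=` cstar_gen X.
Proof. exact: sub_smallest. Qed.

Lemma cstar_gen_min A (X D : set A) : cstar_subalgebra D -> X `<=` D -> cstar_gen X `<=` D.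
Proof. exact: smallest_sub. Qed.

Lemma preimage_subalgebra A B (f : A -> B) (D : set B) :
  star_morphism f -> cstar_subalgebra D -> cstar_subalgebra [set x | D (f x)].
Proof.
move=> fmor [/closedP_cnorm cD D0 Dlin DM Dstar]; split => /=.
- apply/closedP_cnorm => x H; apply: cD => e /H[y Dy xy]; exists (f y) => //.
  rewrite -(star_morphismB fmor); apply: le_lt_trans xy.
  exact: star_morphism_contractive.
- by rewrite (star_morphism0 fmor).
- by move=> a x y Dx Dy; rewrite (star_morphismD fmor) (star_morphismZ fmor); apply: Dlin.
- by move=> x y Dx Dy; rewrite (star_morphismM fmor); apply: DM.
- by move=> x Dx; rewrite (star_morphism_star fmor); apply: Dstar.
Qed.

(** If f (u k) converges, then u is Cauchy because f does not decrease norms. *)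
Lemma range_subalgebra A B (f : A -> B) :
  star_morphism f -> (forall x, cnorm x <= cnorm (f x)) -> cstar_subalgebra (range f).
Proof.
move=> fmor f_iso; split.
- apply/closedP_cnorm => x H.
  have inv_gt0 k : 0 < (k.+1%:R : R)^-1 by rewrite invr_gt0.
  have approx k : exists a, cnorm (x - f a) < k.+1%:R^-1.
    by have [_ [a _ <-] xa] := H _ (inv_gt0 k); exists a.
  have [u xu] := choice approx.
  have inv_lt (e : R) : 0 < e -> exists N, forall i, (N <= i)%N -> i.+1%:R^-1 < e.
    move=> e0; have [N _ HN] := near_infty_natSinv_lt (PosNum e0); by exists N.
  have [|l ul] := @cnorm_complete R A u.
    move=> e e0; have [|N HN] := inv_lt (e / 2); first by rewrite divr_gt0.
    exists N => i j Ni Nj; apply: le_lt_trans (f_iso _) _.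
    rewrite (star_morphismB fmor) -(subrBB (f (u i)) (f (u j)) x).
    apply: le_lt_trans (cnormB _ _) _.
    have := lt_trans (xu i) (HN i Ni); have := lt_trans (xu j) (HN j Nj); lra.
  exists l => //; apply/esym/subr0_eq/(cnorm_eq0_lim (C := 2)) => e e0.
  have [N HN] := inv_lt e e0; have [M HM] := ul e e0.
  have := lt_trans (xu _) (HN _ (leq_maxl N M)); have := HM _ (leq_maxr N M).
  set k := maxn N M => kl xk.
  have -> : x - f l = (x - f (u k)) + f (u k - l) by rewrite (star_morphismB fmor) addrA subrK.
  have := cnormD (x - f (u k)) (f (u k - l)).
  have := star_morphism_contractive fmor (u k - l); lra.
- by exists 0 => //; rewrite (star_morphism0 fmor).
- move=> a _ _ [x _ <-] [y _ <-]; exists (a *: x + y) => //.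
  by rewrite (star_morphismD fmor) (star_morphismZ fmor).
- by move=> _ _ [x _ <-] [y _ <-]; exists (x * y) => //; rewrite (star_morphismM fmor).
- by move=> _ [x _ <-]; exists (star x) => //; rewrite (star_morphism_star fmor).
Qed.

(** This reduces the stability of M under left multiplication by a whole algebra
to the stability under its generators and their adjoints, although M need not be
stable under products. *)
Lemma left_multipliers_subalgebra A (M : set A) :
  closed (M : set (normed_of A)) -> M 0 ->
  (forall (a : R[i]) x y, M x -> M y -> M (a *: x + y)) ->
  cstar_subalgebra [set a | forall b, M b -> M (a * b) /\ M (star a * b)].
Proof.
move=> /closedP_cnorm cM M0 Mlin; split => /=.
- apply/closedP_cnorm => x H b Mb.
  have Hb (e : R) : 0 < e -> exists2 y, (M (y * b) /\ M (star y * b)) & cnorm (x - y) * cnorm b < e.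
    move=> e0; have b0 := cnorm_ge0 b.
    have b1 : 0 < cnorm b + 1 by lra.
    have [|y Hy] := H (e / (cnorm b + 1)); first by rewrite divr_gt0.
    rewrite ltr_pdivlMr // => xy; exists y; first exact: Hy.
    by apply: le_lt_trans xy; apply: ler_wpM2l; [exact: cnorm_ge0 | lra].
  split; apply: cM => e /Hb[y [My Mys] xy].
    by exists (y * b) => //; rewrite -mulrBl; apply: le_lt_trans (cnormM _ _) xy.
  exists (star y * b) => //; rewrite -mulrBl -starB.
  by apply: le_lt_trans (cnormM _ _) _; rewrite cnorm_star.
- by move=> b _; rewrite star0 mul0r.
- move=> a x y Hx Hy b Mb; have [x1 x2] := Hx b Mb; have [y1 y2] := Hy b Mb.
  by rewrite starD starZ !mulrDl -!scalerAl; split; apply: Mlin.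
- move=> x y Hx Hy b Mb; have [y1 y2] := Hy b Mb; have [x1 x2] := Hx b Mb.
  rewrite starM -!mulrA; split; first by have [] := Hx _ y1.
  by have [] := Hy _ x2.
- by move=> x Hx b Mb; have [x1 x2] := Hx b Mb; rewrite starK.
Qed.

Lemma intertwined_subalgebra A B (h : A -> B) (k : A -> B) (v : B) :
  star_morphism h -> star_morphism k ->
  cstar_subalgebra [set a | h a * v = v * k a /\ h (star a) * v = v * k (star a)].
Proof.
move=> hmor kmor.
have diffE x y : h y * v = v * k y -> 
    cnorm (h x * v - v * k x) <= (2 * cnorm v) * cnorm (x - y).
  move=> hy.
  have -> : h x * v - v * k x = h (x - y) * v - v * k (x - y).
    rewrite (star_morphismB hmor) (star_morphismB kmor) mulrBl mulrBr hy.
    by rewrite opprB addrA subrK.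
  have := cnormB (h (x - y) * v) (v * k (x - y)).
  have := cnormM (h (x - y)) v; have := cnormM v (k (x - y)).
  have := star_morphism_contractive hmor (x - y).
  have := star_morphism_contractive kmor (x - y).
  by have := cnorm_ge0 v; nra.
split => /=.
- apply/closedP_cnorm => x H.
  split; apply/subr0_eq/(cnorm_eq0_lim (C := 2 * cnorm v)) => e /H[y [hy hsy] xy].
    apply: (le_trans (diffE x y hy)); apply: ler_wpM2l; last exact: ltW.
    by rewrite mulr_ge0 // cnorm_ge0.
  apply: (le_trans (diffE (star x) (star y) hsy)).
  rewrite -starB cnorm_star; apply: ler_wpM2l; last exact: ltW.
  by rewrite mulr_ge0 // cnorm_ge0.
- by rewrite star0 (star_morphism0 hmor) (star_morphism0 kmor) mul0r mulr0.
- move=> a x y [hx hsx] [hy hsy]; rewrite starD starZ.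
  rewrite !(star_morphismD hmor) !(star_morphismD kmor).
  rewrite !(star_morphismZ hmor) !(star_morphismZ kmor).
  by rewrite !mulrDl !mulrDr -!scalerAl -!scalerAr hx hy hsx hsy.
- move=> x y [hx hsx] [hy hsy].
  rewrite starM !(star_morphismM hmor) !(star_morphismM kmor).
  by rewrite -!mulrA hy hsx !mulrA hx hsy.
- by move=> x [hx hsx]; rewrite starK.
Qed.

End Subalgebras.

(** * The fixed point algebra *)

Section GradedFixedPoints.
Context {R : realType}.

Lemma prim_root_exists (d : nat) : (0 < d)%N -> exists w : R[i], d.-primitive_root w.
Proof.
move=> d0; pose p : {poly R[i]} := 'X^d - 1.
have [r Dp] := closed_field_poly_normal p.
rewrite (monicP _) ?monicXnsubC // scale1r in Dp.
have rn1 : all d.-unity_root r by apply/allP => x; rewrite -root_prod_XsubC -Dp.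
have sz_r : (d < (size r).+1)%N by rewrite -(size_prod_XsubC r id) -Dp size_XnsubC.
have [|x] := hasP (cyclic.has_prim_root d0 rn1 _ sz_r); last by exists x.
by rewrite -separable.separable_prod_XsubC -Dp cyclotomic.separable_Xn_sub_1 // pnatr_eq0 -lt0n.
Qed.

Lemma sum_prim_root (w : R[i]) (d j : nat) : d.-primitive_root w ->
  \sum_(k < d) (w ^+ k) ^+ j = if (d %| j)%N then d%:R else 0.
Proof.
move=> wd; under eq_bigr do rewrite exprAC.
case: ifPn => dj.
  have -> : w ^+ j = 1 by apply/eqP; rewrite -(prim_order_dvd wd).
  by under eq_bigr do rewrite expr1n; rewrite sumr_const card_ord.
have wj1 : w ^+ j - 1 != 0 by rewrite subr_eq0 -(prim_order_dvd wd).
apply: (mulfI wj1); rewrite mulr0 -subrX1 exprAC (prim_expr_order wd).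
by rewrite expr1n subrr.
Qed.

Context (m n d : nat) (A : cstarAlgType R) (z s : A) (beta : R[i] -> A -> A).
Context (n0 : (0 < n)%N) (d0 : (0 < d)%N) (nd : coprime n d).
Context (mn : (n = m + d)%N \/ (m = n + d)%N).
Context (zs : corner_rep m n 1 z s).
Context (beta_aut : forall t, d.-unity_root t -> star_automorphism (beta t)).
Context (beta_z : forall t, d.-unity_root t -> beta t z = t *: z).
Context (beta_s : forall t, d.-unity_root t -> beta t s = s).
Context (gen_zs : forall D, cstar_subalgebra D -> D z -> D s -> forall x : A, D x).

Let D : set A := cstar_gen [set z ^+ d; s].

Let uz k : unitary (z ^+ k).
Proof. by apply: expr_unitary; case: zs. Qed.

Let DM x y : D x -> D y -> D (x * y).
Proof. by have [_ _ _ H _] := @cstar_gen_subalgebra R A [set z ^+ d; s]; apply: H. Qed.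

Let Dstar x : D x -> D (star x).
Proof. by have [_ _ _ _ H] := @cstar_gen_subalgebra R A [set z ^+ d; s]; apply: H. Qed.

Let Ds : D s. Proof. by apply: sub_cstar_gen; right. Qed.

Lemma fixed_subalgebra_unit : D 1.
Proof.
have Dzd : D (z ^+ d) by apply: sub_cstar_gen; left.
by rewrite -(uz d).1; apply: DM => //; apply: Dstar.
Qed.

Lemma fixed_subalgebra_zX k : D (z ^+ (d * k)).
Proof.
elim: k => [|k IH]; first by rewrite muln0; exact: fixed_subalgebra_unit.
by rewrite mulnS exprD; apply: DM => //; apply: sub_cstar_gen; left.
Qed.

(** Choose q with n q = j modulo d.  Up to powers of z^d, conjugation by z^j is
conjugation by z^(n q), which sends s to s z^(m q) star (z^(n q)), that is, to s
times a power of z^d or of its adjoint. *)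
Lemma fixed_subalgebra_conj j : D (z ^+ j * s * star (z ^+ j)).
Proof.
have [q [r nqE]] : exists q r, (n * q = j + d * r)%N.
  pose c := (chinese n d 0 j + n * d * j)%N.
  have jc : (j <= c)%N by apply: leq_trans (leq_addl _ _); rewrite leq_pmull ?muln_gt0 ?n0.
  have /dvdnP[q cq] : (n %| c)%N.
    apply: dvdn_add; last by rewrite -mulnA dvdn_mulr.
    by apply/eqP; rewrite (chinese_modl nd) mod0n.
  have /dvdnP[r cr] : (d %| c - j)%N.
    by rewrite -eqn_mod_dvd // /c (mulnC n) -mulnA addnC mulnC modnMDl (chinese_modr nd).
  by exists q, r; rewrite mulnC -cq mulnC -cr subnKC.
have zq : D (z ^+ (m * q) * star (z ^+ (n * q))).
  case: mn => ->; rewrite mulnDl exprD.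
    rewrite -exprD addnC exprD starM mulrA (uz _).2 mul1r.
    by apply: Dstar; exact: fixed_subalgebra_zX.
  rewrite -exprD addnC exprD -mulrA (uz _).2 mulr1.
  exact: fixed_subalgebra_zX.
have -> : z ^+ j * s * star (z ^+ j) =
    star (z ^+ (d * r)) * (s * (z ^+ (m * q) * star (z ^+ (n * q)))) * z ^+ (d * r).
  rewrite (mulrA s) -(corner_rep_relX _ zs) nqE addnC exprD starM.
  by rewrite !mulrA (uz _).1 mul1r -!mulrA (uz _).1 mulr1.
by do 2?apply: DM; do ?apply: DM => //; do ?apply: Dstar; exact: fixed_subalgebra_zX.
Qed.

Lemma fixed_points_subalgebra : cstar_subalgebra (fixed_points d beta).
Proof.
split.
- apply/closedP_cnorm => x H t td; have [tmor _] := beta_aut td.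
  apply/subr0_eq/(cnorm_eq0_lim (C := 2)) => e /H[y fy xy].
  have -> : beta t x - x = beta t (x - y) - (x - y).
    by rewrite (star_morphismB tmor) (fy _ td) opprB addrA subrK.
  have := cnormB (beta t (x - y)) (x - y).
  have := star_morphism_contractive tmor (x - y); lra.
- by move=> t /beta_aut[tmor _]; rewrite (star_morphism0 tmor).
- move=> a x y fx fy t td; have [tmor _] := beta_aut td.
  by rewrite (star_morphismD tmor) (star_morphismZ tmor) fx ?fy.
- move=> x y fx fy t td; have [tmor _] := beta_aut td.
  by rewrite (star_morphismM tmor) fx ?fy.
- move=> x fx t td; have [tmor _] := beta_aut td.
  by rewrite (star_morphism_star tmor) fx.
Qed.

Let beta1 t : d.-unity_root t -> beta t 1 = 1.
Proof.
move=> td; have [tmor [b' _ bK]] := beta_aut td.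
by rewrite -[LHS]mulr1 -[X in _ * X]bK -(star_morphismM tmor) mul1r bK.
Qed.

Lemma beta_zX t j : d.-unity_root t -> beta t (z ^+ j) = t ^+ j *: z ^+ j.
Proof.
move=> td; have [tmor _] := beta_aut td.
case: j => [|j]; first by rewrite beta1 // scale1r.
by rewrite (star_morphismX tmor) beta_z // exprZn.
Qed.

Lemma sub_fixed_points : D `<=` fixed_points d beta.
Proof.
apply: cstar_gen_min; first exact: fixed_points_subalgebra.
move=> x [->|->] t td; last exact: beta_s.
by rewrite beta_zX //; move: td => /unity_rootP ->; rewrite scale1r.
Qed.

(** E is the average of beta over the d-th roots of unity, M the set of all a
such that every E (z^j a) lies in D, and L the set of left multipliers of M; L
contains the generators, hence everything, and so does M = L 1. *)
Lemma fixed_points_gen : fixed_points d beta = D.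
Proof.
apply/seteqP; split=> [x fx|]; last exact: sub_fixed_points.
have [w wd] := prim_root_exists d0.
have wu k : d.-unity_root (w ^+ k).
  by apply/unity_rootP; rewrite exprAC (prim_expr_order wd) expr1n.
pose r : R := d%:R^-1.
pose E a : A := r%:C *: \sum_(k < d) beta (w ^+ k) a.
have rd : r%:C * d%:R = 1.
  by rewrite -(rmorph_nat (real_complex R)) -rmorphM mulVf // pnatr_eq0 -lt0n.
have E_add a b : E (a + b) = E a + E b.
  rewrite /E -scalerDr -big_split /=; congr (_ *: _); apply: eq_bigr => k _.
  by have [tmor _] := beta_aut (wu k); rewrite (star_morphismD tmor).
have E_scale c a : E (c *: a) = c *: E a.
  rewrite /E scalerA mulrC -scalerA; congr (_ *: _); rewrite scaler_sumr; apply: eq_bigr => k _.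
  by have [tmor _] := beta_aut (wu k); rewrite (star_morphismZ tmor).
have E_contr a : cnorm (E a) <= cnorm a.
  rewrite cnormZr ger0_norm ?invr_ge0 // ler_pdivrMl ?ltr0n //.
  apply: (le_trans (cnorm_sum _ _ _)); rewrite mulr_natl -[X in _ *+ X]card_ord -sumr_const.
  apply: ler_sum => k _; have [tmor _] := beta_aut (wu k).
  exact: star_morphism_contractive.
have E_mod a b : D a -> E (a * b) = a * E b.
  move=> Da; rewrite /E -scalerAr mulr_sumr; congr (_ *: _); apply: eq_bigr => k _.
  have [tmor _] := beta_aut (wu k); rewrite (star_morphismM tmor).
  by rewrite (sub_fixed_points Da).
have E_fix : E x = x.
  rewrite /E; under eq_bigr do rewrite fx //.
  by rewrite sumr_const card_ord -scaler_nat scalerA rd scale1r.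
have [cD D0 Dlin _ _] := @cstar_gen_subalgebra R A [set z ^+ d; s].
have E_zX j : D (E (z ^+ j)).
  rewrite /E; under eq_bigr do rewrite beta_zX //.
  rewrite -scaler_suml sum_prim_root // scalerA.
  case: ifP => [/dvdnP[k ->]|_]; last by rewrite mulr0 scale0r.
  by rewrite rd scale1r mulnC; apply: fixed_subalgebra_zX.
pose M : set A := [set a | forall j, D (E (z ^+ j * a))].
pose L : set A := [set a | forall b, M b -> M (a * b) /\ M (star a * b)].
have L_sub : cstar_subalgebra L.
  apply: left_multipliers_subalgebra.
  - apply/closedP_cnorm => y H j; move/closedP_cnorm: cD; apply => e /H[y' My' yy'].
    exists (E (z ^+ j * y')); first exact: My'.
    have -> : E (z ^+ j * y) - E (z ^+ j * y') = E (z ^+ j * (y - y')).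
      by rewrite mulrBr -(scaleN1r (z ^+ j * y')) E_add E_scale scaleN1r.
    apply: le_lt_trans (E_contr _) _; apply: le_lt_trans (cnormM _ _) _.
    apply: le_lt_trans yy'; rewrite ler_piMl ?cnorm_ge0 //.
    exact: cnorm_isometry (uz _).1.
  - by move=> j; have := E_scale 0 0; rewrite mulr0 !scale0r => ->; exact: D0.
  - by move=> a y y' My My' j; rewrite mulrDr -scalerAr E_add E_scale; apply: Dlin; [exact: My | exact: My'].
have M1 : M 1 by move=> j; rewrite mulr1.
have z_comm j : z ^+ j * star z = star z * z ^+ j.
  have [[z1 z2] _ _ _ _] := zs.
  elim: j => [|j IH]; first by rewrite mul1r mulr1.
  by rewrite {1}exprSr -mulrA z2 mulr1 exprS mulrA z1 mul1r.
have Lz : L z.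
  move=> b Mb; split=> j; first by rewrite mulrA -exprSr.
  (* star z is z^(d - 1) up to the adjoint of z^d, which lies in D. *)
  have -> : z ^+ j * (star z * b) = star (z ^+ d) * (z ^+ (d.-1 + j) * b).
    have zz : star (z ^+ d) * z ^+ d.-1 = star z.
      by rewrite -{1}(prednK d0) exprSr starM -mulrA (uz _).1 mulr1.
    by rewrite exprD !mulrA zz z_comm.
  have Dzd : D (star (z ^+ d)).
    by apply: Dstar; have := fixed_subalgebra_zX 1; rewrite muln1.
  by rewrite E_mod //; apply: DM => //; exact: Mb.
(* z^j c = (z^j c star (z^j)) z^j, and E is linear over the first factor, in D. *)
have Ls : L s.
  have conj j (c : A) : z ^+ j * c = z ^+ j * c * star (z ^+ j) * z ^+ j.
    by rewrite -mulrA (uz _).1 mulr1.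
  move=> b Mb; split=> j; rewrite mulrA conj -mulrA E_mod.
  - by apply: DM => //; apply: fixed_subalgebra_conj.
  - exact: fixed_subalgebra_conj.
  - apply: DM => //; have /Dstar := fixed_subalgebra_conj j.
    by rewrite !starM starK mulrA.
  - by have /Dstar := fixed_subalgebra_conj j; rewrite !starM starK mulrA.
have [/(_ 0%N) Mx _] := gen_zs L_sub Lz Ls x 1 M1.
by move: Mx; rewrite mulr1 mul1r E_fix.
Qed.

End GradedFixedPoints.

(** * Fixed points and the isomorphism *)

Theorem proposition4p4 (R : realType) (m n : nat)
    (hm : (1 <= m)%N) (hn : (2 <= n)%N) (hmn : coprime m n)
    (hd : (2 <= `|n%:Z - m%:Z|)%N)
    (A : cstarAlgType R) (z : A) (S : nat -> A) (hA : is_O m n z S)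
    (beta : R[i] -> A -> A)
    (hbeta : unity_root_action `|n%:Z - m%:Z|%N beta)
    (hbeta_z : forall t, `|n%:Z - m%:Z|%N.-unity_root t -> beta t z = t *: z)
    (hbeta_S : forall t, `|n%:Z - m%:Z|%N.-unity_root t -> beta t (S 1%N) = S 1%N) :
  fixed_points `|n%:Z - m%:Z|%N beta
    = cstar_gen [set z ^+ `|n%:Z - m%:Z|%N; S 1%N]
  /\ star_isomorphic_to_subalgebra A
       (cstar_gen [set z ^+ `|n%:Z - m%:Z|%N; S 1%N]).
Proof.
have mn : (n = m + `|n%:Z - m%:Z| \/ m = n + `|n%:Z - m%:Z|)%N by lia.
have n0 : (0 < n)%N by apply: ltnW.
move: (`|n%:Z - m%:Z|%N) mn hd hbeta hbeta_z hbeta_S => d mn d2 [beta_aut _ _] beta_z beta_S.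
have d0 : (0 < d)%N by apply: ltnW.
have md : coprime m d.
  case: mn => E; move: hmn; rewrite E /coprime ?gcdnDr //.
    by rewrite gcdnDl.
  by rewrite gcdnC gcdnDl gcdnC [gcdn (n + d) d]gcdnC gcdnDr gcdnC.
have nd : coprime n d.
  case: mn => E; move: hmn; rewrite E /coprime.
    by rewrite gcdnDl [gcdn (m + d) d]gcdnC gcdnDr gcdnC.
  by rewrite gcdnC gcdnDl.
have [hO hgen huniv] := hA; have [zs SE] := O_relations_corner_rep n0 hO.
set s := S 1%N in zs SE beta_S *.
have gen_zs (D : set A) : cstar_subalgebra D -> D z -> D s -> forall x, D x.
  move=> DA Dz Ds x; have [_ _ _ DM _] := DA.
  have : [set: A] x by [].
  rewrite -hgen; apply: cstar_gen_min => // y [->|[i /= hi <-]] //.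
  rewrite SE //; elim: i.-1 => [|j IH]; first by rewrite mul1r.
  by rewrite exprS -mulrA; apply: DM.
split; first exact: (fixed_points_gen n0 d0 nd mn zs).
have dn : coprime d n by rewrite coprime_sym.
have [f [[fmor fz fS] _]] := huniv A _ _ (corner_rep_O_relations n0 (corner_rep_expr n0 dn zs)).
have [w [t [v0 [wt v0v0 wv tv tsv]]]] : exists w t v0 : A,
    [/\ corner_rep m n 1 w t, star v0 * v0 = 1, w ^+ d * v0 = v0 * z,
        t * v0 = v0 * s & star t * v0 = v0 * star s].
  have cS : cuntz_family (fun i : 'I_n => S i.+1).
    have [_ Siso _ _ Ssum] := hO.
    have Ssum' : \sum_(i < n) S i.+1 * star (S i.+1) = 1.
      by rewrite -Ssum big_add1 big_mkord.
    split=> [i j|//]; have [->|ij] := eqVneq i j; first by apply: Siso; rewrite ltn_ord.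
    apply: (isometries_orthogonal (V := fun k : 'I_n => S k.+1)) ij => // k.
    by apply: Siso; rewrite ltn_ord.
  have [|N dN [V cV]] := large_cuntz_family d _ cS; first by rewrite card_ord.
  exact: (root_extension zs n0 hm d0 dN md nd cV).
have [g [[gmor gw gT] _]] := huniv A _ _ (corner_rep_O_relations n0 wt).
have fs : f s = s by rewrite fS // mul1r.
have gs : g s = t by rewrite gT // mul1r.
have gfmor : star_morphism (g \o f).
  split=> [a x y|x y|x] /=.
  - by rewrite (star_morphismD fmor) (star_morphismZ fmor) (star_morphismD gmor)
      (star_morphismZ gmor).
  - by rewrite (star_morphismM fmor) (star_morphismM gmor).
  - by rewrite (star_morphism_star fmor) (star_morphism_star gmor).
have gfz : g (f z) = w ^+ d.
  by rewrite fz -(prednK d0) (star_morphismX gmor) gw.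
have gfM (x : A) : star (g (f x)) = g (f (star x)).
  by rewrite (star_morphism_star fmor) (star_morphism_star gmor).
have idmor : star_morphism (@id A) by [].
have gf x : g (f x) * v0 = v0 * x.
  suff [] : (g \o f) x * v0 = v0 * x /\ (g \o f) (star x) * v0 = v0 * star x by [].
  apply: (gen_zs _ (intertwined_subalgebra v0 gfmor idmor)) => /=; last first.
    by rewrite -gfM fs gs.
  have [[z1 z2] _ _ _ _] := zs; have [[w1 w2] _ _ _ _] := wt.
  have [wd1 _] := expr_unitary d (conj w1 w2).
  rewrite -gfM gfz; split=> //.
  by rewrite -[LHS]mulr1 -z2 -mulrA (mulrA v0) -wv !mulrA wd1 mul1r.
have v0_le1 := cnorm_isometry v0v0.
have f_iso x : cnorm x <= cnorm (f x).
  have {1}-> : x = star v0 * (g (f x) * v0) by rewrite gf mulrA v0v0 mul1r.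
  apply: le_trans (cnormM _ _) _; rewrite cnorm_star.
  apply: le_trans (ler_piMl (cnorm_ge0 _) v0_le1) _.
  apply: le_trans (cnormM _ _) _; apply: le_trans (ler_piMr (cnorm_ge0 _) v0_le1) _.
  exact: star_morphism_contractive.
exists f; split=> //; split=> [x _|x y _ _ fxy|].
- apply: (gen_zs [set x | cstar_gen [set z ^+ d; s] (f x)]) => /=.
  + exact: preimage_subalgebra fmor (cstar_gen_subalgebra _).
  + by rewrite fz; apply: sub_cstar_gen; left.
  + by rewrite fs; apply: sub_cstar_gen; right.
- apply/subr0_eq/cnorm0_eq0/eqP; rewrite eq_le cnorm_ge0 andbT.
  by apply: le_trans (f_iso _) _; rewrite (star_morphismB fmor) fxy subrr cnorm0.
- apply: cstar_gen_min; first exact: range_subalgebra.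
  by move=> _ [->|->]; [exists z | exists s].
Qed.
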